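(* Let $n \geq 4$ be an integer and let $S$ be the sequence obtained from the canonical recycle sequence $\mathcal{R}_{n-1}$ by moving its first two entries to the end (i.e. if $\mathcal{R}_{n-1} = r_1, r_2, \ldots, r_k$ then $S = r_3, \ldots, r_k, r_1, r_2$). Then for every $m \in \{2,3,\ldots,n\}$, the sequence $\mathrm{rewind}_{m}(S)$ (formed with parameter $n$) is a Hamilton sequence for the restricted incomplete rotator graph $\mathrm{Rot}_n(R, m)$ with $R = \{n-2, n-1, n\}$.
   Context: For $n \geq 1$, $\Pi_n$ denotes the set of strings $a_1 \cdots a_n$ that are permutations of $\{1,\ldots,n\}$. For $2 \le r \le n$, the prefix-rotation $\sigma_r$ maps $a_1 \cdots a_n$ to $a_2 \cdots a_r a_1 a_{r+1} \cdots a_n$. For $R \subseteq \{2,\ldots,n\}$ and $m \in \{1,\ldots,n\}$, the restricted incomplete rotator graph $\mathrm{Rot}_n(R,m)$ is the directed graph whose nodes are the strings of $\Pi_n$ whose last symbol is at most $m$, with an arc from $\mathbf{a}$ to $\mathbf{b}$ whenever both are nodes and $\mathbf{b} = \mathbf{a}\sigma_r$ for some $r \in R$. A Hamilton sequence for such a graph with $N$ nodes is a sequence $r_1,\ldots,r_N$ of elements of $R$ such that, with $v_0 = n\,(n{-}1)\cdots 1$ and $v_i = v_{i-1}\sigma_{r_i}$, the strings $v_0,\ldots,v_{N-1}$ are pairwise distinct and are exactly the nodes of the graph, and $v_N = v_0$. Recycle operation: for a sequence $S = r_1, r_2, \ldots$ and integer $k$, $\mathrm{recycle}_k(S)$ replaces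 each $r_i$ by $k, k$, then $k{-}1$ repeated $r_i - 1$ times, then $k$ repeated $k - r_i - 1$ times. Canonical recycle sequences: $\mathcal{R}_1 = 1$ and $\mathcal{R}_k = \mathrm{recycle}_k(\mathcal{R}_{k-1})$ for $k>1$. Rewind operation: if $S = T, n{-}1, n{-}1$ is a sequence whose last two entries equal $n-1$ (its maximum), and $m \ge 2$, then $\mathrm{rewind}_m(S)$ is the concatenation of: $T, n{-}1, n$; then $m-2$ copies of the block $T, n$; then $T, n{-}1, n$; then $m-2$ copies of $n$. *)

(* Defs.v *)
From mathcomp Require Import all_boot.

Set Implicit Arguments.
Unset Strict Implicit.
Unset Printing Implicit Defensive.

(* Strings carry the symbols 1, ..., n, so [iota 1 n] is the string 1 2 ... n. *)
Definition perm_strings (n : nat) : seq (seq nat) := permutations (iota 1 n).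

(* Prefix-rotation: a_1 ... a_r a_{r+1} ... a_n |-> a_2 ... a_r a_1 a_{r+1} ... a_n. *)
Definition sigma (r : nat) (a : seq nat) : seq nat :=
  rot 1 (take r a) ++ drop r a.

Definition rot_nodes (n m : nat) : seq (seq nat) :=
  [seq a <- perm_strings n | last 0 a <= m].

(* The set R of admissible indices is given by a list of its elements. *)
Definition rot_arc (n : nat) (R : seq nat) (m : nat) : rel (seq nat) :=
  fun a b => [&& a \in rot_nodes n m, b \in rot_nodes n m
               & has (fun r => b == sigma r a) R].

(* The string v_i reached from v_0 = n (n-1) ... 1 after the first i rotations. *)
Definition visit (n : nat) (s : seq nat) (i : nat) : seq nat :=
  foldl (fun a r => sigma r a) (rev (iota 1 n)) (take i s).

Definition hamilton_sequence (n : nat) (R : seq nat) (m : nat) (s : seq nat)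
    : Prop :=
  [/\ size s = size (rot_nodes n m),
      {subset s <= R},
      uniq (mkseq (visit n s) (size s)),
      mkseq (visit n s) (size s) =i rot_nodes n m
    & visit n s (size s) = visit n s 0].

(* The two truncated subtractions are exact whenever 1 <= r < k, which holds
   for all entries to which the operation is applied (see [canonical_mem]). *)
Definition recycle (k : nat) (s : seq nat) : seq nat :=
  flatten [seq [:: k; k] ++ nseq (r - 1) (k - 1) ++ nseq (k - r - 1) k | r <- s].

(* The value at 0 is a dummy: the sequences are indexed from 1. *)
Fixpoint canonical (k : nat) : seq nat :=
  match k with
  | 0 => [::]
  | 1 => [:: 1]
  | (_.+1 as k').+1 => recycle k'.+1 (canonical k')
  end.

(* Meaningful when s = T ++ [:: n - 1; n - 1] (see [canonical_rot2]) and
   2 <= m; T is then s without its last two entries. *)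
Definition rewind (n m : nat) (s : seq nat) : seq nat :=
  let T := take (size s - 2) s in
  (T ++ [:: n - 1; n])
    ++ flatten (nseq (m - 2) (T ++ [:: n]))
    ++ (T ++ [:: n - 1; n])
    ++ nseq (m - 2) n.

Lemma hamilton_sequence_cycle (n : nat) (R : seq nat) (m : nat) (s : seq nat) :
  hamilton_sequence n R m s ->
  ucycle (rot_arc n R m) (mkseq (visit n s) (size s)).
Proof.
case=> _ sR Us nodes clo; rewrite /ucycle Us andbT.
have [s0|s_gt0] := posnP (size s); first by rewrite s0.
have node i : i <= size s -> visit n s i \in rot_nodes n m.
  rewrite leq_eqVlt => /predU1P[->|lt_is]; last by rewrite -nodes map_f // mem_iota.
  by rewrite clo -nodes map_f // mem_iota.
have -> : mkseq (visit n s) (size s)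
    = visit n s 0 :: [seq visit n s i | i <- iota 1 (size s).-1].
  by rewrite /mkseq; case: (size s) s_gt0.
rewrite /= -[X in rcons _ X]clo -map_rcons.
have -> : rcons (iota 1 (size s).-1) (size s) = iota 1 (size s).
  case: (size s) s_gt0 => // N _.
  by have := iotaD 1 N 1; rewrite addn1 cats1 add1n => <-.
apply/(pathP [::]) => i; rewrite size_map size_iota => lt_is.
have -> : nth [::] (visit n s 0 :: [seq visit n s i | i <- iota 1 (size s)]) i
    = visit n s i.
  by case: i lt_is => //= i /ltnW lt_is; rewrite (nth_map 0) ?size_iota // nth_iota.
rewrite (nth_map 0) ?size_iota // nth_iota // add1n.
rewrite /rot_arc !node ?(ltnW lt_is) //=; apply/hasP.
exists (nth 0 s i); first by apply: sR; rewrite mem_nth.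
by rewrite /visit (take_nth 0) // foldl_rcons.
Qed.

Lemma canonical_mem (k r : nat) :
  1 < k -> r \in canonical k -> (r == k - 1) || (r == k).
Proof.
case: k => [|[|k]] // _ /flatten_mapP[x _].
rewrite !mem_cat !inE !mem_nseq => /orP[/orP[]/eqP->|/orP[]/andP[_ /eqP->]];
  by rewrite eqxx ?orbT.
Qed.

Lemma canonical_rot2 (k : nat) :
  1 < k -> exists T, rot 2 (canonical k) = T ++ [:: k; k].
Proof.
move=> k_gt1; suff [s ->]: exists s, canonical k = [:: k, k & s].
  by exists s; rewrite /rot /= drop0 take0.
elim: k k_gt1 => [|[|[|k]] IHk] // _; first by exists [::].
have [//|s def] := IHk.
change (exists s, recycle k.+3 (canonical k.+2) = [:: k.+3, k.+3 & s]).
by rewrite def /recycle /=; eexists.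
Qed.

(* Main.v *)
Require Import Defs.
From mathcomp Require Import all_boot.
From mathcomp Require Import zify.

(** Since all nodes are distinct, it is enough that the walk visits every node,
    that it has as many steps as there are nodes, and that it returns to its
    start.

    Recycling: the block of k instructions replacing r carries x a to
    x (a sigma_r), and its (q + 2)-nd string is x (a sigma_q) rotated left by
    q + 1: this needs q <= r for all q <= k - 2, which holds as only r = k - 2
    and r = k - 1 occur.  As sigma_q is a bijection, every string is visited if
    every a is.

    Rewinding: put k = n - 1 and let T be the canonical sequence of index k
    without its first two entries, so that T acts as sigma_k^-2 and visits
    everything with the given last symbol except the last two strings of the
    cycle.  Let D_i be n ... 2 1 rotated right by i, whose last symbol is
    i + 1.  The first T, k, n visits all strings ending in 1 and leads from D_0
    to D_1 sigma_k; each T, n leads from D_i sigma_k to D_(i+1) sigma_k and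
    visits all strings ending in i + 1 except D_i; the second T, k, n completes
    the last symbol m and leads to D_(m-2); the final rotations then pick up
    the omitted strings D_(m-2), ..., D_1 and end in D_0. *)

(** * Walks and the strings they visit *)

Definition walk (a s : seq nat) : seq nat := foldl (fun b r => sigma r b) a s.

(** The endpoint [walk a s] is left out, so that a closed walk lists its start only once. *)
Fixpoint trail (a s : seq nat) : seq (seq nat) :=
  if s is r :: s' then a :: trail (sigma r a) s' else [::].

Lemma walk_cat (a s t : seq nat) : walk a (s ++ t) = walk (walk a s) t.
Proof. exact: foldl_cat. Qed.

Lemma trail_cat (a s t : seq nat) :
  trail a (s ++ t) = trail a s ++ trail (walk a s) t.
Proof. by elim: s a => //= r s IHs a; rewrite IHs. Qed.

Lemma size_trail (a s : seq nat) : size (trail a s) = size s.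
Proof. by elim: s a => //= r s IHs a; rewrite IHs. Qed.

Lemma mkseq_visit (n : nat) (s : seq nat) :
  mkseq (visit n s) (size s) = trail (rev (iota 1 n)) s.
Proof.
rewrite /visit; elim: s (rev _) => //= r s IHs a.
by rewrite /mkseq /= -IHs -[1]/(1 + 0) iotaDl -map_comp.
Qed.

Lemma perm_sigma (r : nat) (a : seq nat) : perm_eq (sigma r a) a.
Proof. by rewrite /sigma -{3}(cat_take_drop r a) perm_cat2r perm_rot. Qed.

Lemma size_sigma (r : nat) (a : seq nat) : size (sigma r a) = size a.
Proof. exact/perm_size/perm_sigma. Qed.

Lemma sigma_size (r : nat) (a : seq nat) : size a = r -> sigma r a = rot 1 a.
Proof. by move=> <-; rewrite /sigma take_size drop_size cats0. Qed.

Lemma sigma_rcons (r x : nat) (a : seq nat) :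
  r <= size a -> sigma r (rcons a x) = rcons (sigma r a) x.
Proof. by move=> ra; rewrite /sigma drop_rcons // -cats1 takel_cat // -rcons_cat. Qed.

Lemma walk_rcons (x : nat) (a s : seq nat) :
  all (fun r => r <= size a) s -> walk (rcons a x) s = rcons (walk a s) x.
Proof.
elim: s a => //= r s IHs a /andP[ra sa].
by rewrite sigma_rcons // IHs // size_sigma.
Qed.

Lemma trail_rcons (x : nat) (a s : seq nat) :
  all (fun r => r <= size a) s ->
  trail (rcons a x) s = [seq rcons b x | b <- trail a s].
Proof.
elim: s a => //= r s IHs a /andP[ra sa].
by rewrite sigma_rcons // IHs // size_sigma.
Qed.

Lemma walk_nseq (r q p : nat) (f : nat -> seq nat) :
  (forall i, q <= i < q + p -> sigma r (f i) = f i.+1) ->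
  walk (f q) (nseq p r) = f (q + p).
Proof.
elim: p q => [|p IHp] q fS; first by rewrite addn0.
rewrite /= fS; last by lia.
by rewrite IHp ?addSnnS // => i qi; apply: fS; lia.
Qed.

Lemma trail_nseq (r q p : nat) (f : nat -> seq nat) :
  (forall i, q <= i < q + p -> sigma r (f i) = f i.+1) ->
  trail (f q) (nseq p r) = [seq f i | i <- iota q p].
Proof.
elim: p q => [|p IHp] q fS //=.
rewrite fS; last by lia.
by rewrite IHp // => i qi; apply: fS; lia.
Qed.

(** * Recycling and the canonical cycles *)

(* The string visited q + 1 steps after x :: a in the block of recycle. *)
Definition slide (x : nat) (a : seq nat) (q : nat) : seq nat :=
  drop q a ++ x :: rot 1 (take q a).

Definition recycle_block (k r : nat) : seq nat :=
  [:: k; k] ++ nseq (r - 1) (k - 1) ++ nseq (k - r - 1) k.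

(** The last symbol is the head of [a] and stays fixed, while the front symbol, entry [q] of [a]
    counted from 0, moves to just before it. *)
Lemma sigma_slide (x q : nat) (a : seq nat) :
  0 < q < size a -> sigma (size a) (slide x a q) = slide x a q.+1.
Proof.
case: a => [|y a] /= ; first by lia.
case: q => // q; rewrite /= ltnS /slide /= !rot1_cons => qa.
rewrite (drop_nth 0) // (take_nth 0) // -rcons_cons -rcons_cat.
have sz : size ((nth 0 a q :: drop q.+1 a) ++ x :: take q a) = (size a).+1.
  by rewrite size_cat /= size_drop size_take qa; lia.
rewrite sigma_rcons ?sz // sigma_size // rot1_cons -!rcons_cons.
by rewrite rcons_cat rcons_cat.
Qed.

(** For [r = size a] the slide already is the target; for [r.+1 = size a] only the last symbol of
    [a] still precedes [x], and one full rotation sends it to the end. *)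
Lemma slide_last (x r : nat) (a : seq nat) :
  0 < r -> (r == size a) || (r.+1 == size a) ->
  walk (slide x a r) (nseq (size a - r) (size a).+1) = x :: sigma r a.
Proof.
move=> r0 /orP[]/eqP ra; rewrite -{1}ra.
  by rewrite subnn /= sigma_size // /slide ra drop_size take_size.
rewrite subSnn /= /slide.
have := size_drop r a; rewrite -ra subSnn {2}/sigma.
case: (drop r a) => [|y []] //= _.
have sz : size (rot 1 (take r a)) = r by rewrite size_rot size_takel -?ra.
by rewrite sigma_size /= ?sz // rot1_cons -cats1.
Qed.

(** Covers the entries of [canonical k] for positive [k]; requiring [0 < r] keeps the subtractions
    in [recycle_block k.+1 r] exact. *)
Definition recycle_index (k : nat) : pred nat :=
  fun r => (0 < r) && ((r == k) || (r.+1 == k)).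

Lemma size_recycle_block (k r : nat) :
  recycle_index k r -> size (recycle_block k.+1 r) = k.+1.
Proof. by rewrite /recycle_index /= size_cat !size_nseq; lia. Qed.

Lemma sigma_slide0 (x : nat) (a : seq nat) :
  0 < size a ->
  sigma (size a).+1 (x :: a) = slide x a 0
  /\ sigma (size a).+1 (slide x a 0) = slide x a 1.
Proof.
case: a => // y a _; rewrite /slide /= drop0 take0.
by split; rewrite sigma_size /= ?size_cat /= ?addn1 // rot1_cons -!cats1 -?catA.
Qed.

Lemma walk_recycle_block (x r : nat) (a : seq nat) :
  recycle_index (size a) r ->
  walk (x :: a) (recycle_block (size a).+1 r) = x :: sigma r a.
Proof.
case/andP=> r0 ra; have a0 : 0 < size a by lia.
have [s0 s1] := sigma_slide0 x _ a0.
rewrite walk_cat /= s0 s1 walk_cat (subn1 (size a).+1) /=.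
rewrite (walk_nseq _ 1 _ (slide x a)); last first.
  by move=> i ir; apply: sigma_slide; lia.
by rewrite subnKC // subSn ?subn1 /=; [apply: slide_last | lia].
Qed.

Lemma mem_trail_recycle_block (x r q : nat) (a : seq nat) :
  recycle_index (size a) r -> q < size a ->
  slide x a q \in trail (x :: a) (recycle_block (size a).+1 r).
Proof.
case/andP=> r0 ra qa; have a0 : 0 < size a by lia.
have [s0 s1] := sigma_slide0 x _ a0.
rewrite trail_cat /= s0 s1 2!inE; case: q qa => [|q] qa; first by rewrite eqxx orbT.
have sS i : 1 <= i < 1 + (r - 1) -> sigma (size a) (slide x a i) = slide x a i.+1.
  by move=> ir; apply: sigma_slide; lia.
rewrite trail_cat (subn1 (size a).+1) /= (trail_nseq _ 1 _ (slide x a)) //.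
rewrite (walk_nseq _ 1 _ (slide x a)) //.
rewrite mem_cat; have [qr|rq] := ltnP q.+1 r.
  by rewrite map_f ?orbT // mem_iota; lia.
(* Since [q.+1 < size a], here [r = size a - 1]: exactly one full rotation is left, and it starts
   from the wanted slide. *)
have -> : q.+1 = r by lia.
rewrite subnKC // (_ : _ - r - 1 = 1); last by lia.
by rewrite /= inE eqxx !orbT.
Qed.

Lemma size_recycle (k : nat) (s : seq nat) :
  all (recycle_index k) s -> size (recycle k.+1 s) = k.+1 * size s.
Proof.
elim: s => [|r s IHs] /=; first by rewrite muln0.
move=> /andP[kr ks]; have := IHs ks; have := size_recycle_block _ _ kr.
by rewrite /recycle /recycle_block /= !size_cat mulnS; lia.
Qed.

Lemma walk_recycle (x : nat) (a s : seq nat) :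
  all (recycle_index (size a)) s ->
  walk (x :: a) (recycle (size a).+1 s) = x :: walk a s.
Proof.
elim: s a => //= r s IHs a /andP[ar sa].
rewrite -(size_sigma r a) in sa; rewrite -IHs // size_sigma.
by rewrite -[x :: sigma r a](walk_recycle_block x _ _ ar) -walk_cat.
Qed.

Lemma mem_trail_recycle (x : nat) (a s b : seq nat) :
  all (recycle_index (size a)) s -> b \in trail a s ->
  x :: b \in trail (x :: a) (recycle (size a).+1 s) /\
  forall q, q < size a -> slide x b q \in trail (x :: a) (recycle (size a).+1 s).
Proof.
elim: s a => // r s IHs a /andP[ar sa].
have -> : recycle (size a).+1 (r :: s)
  = recycle_block (size a).+1 r ++ recycle (size a).+1 s by [].
rewrite trail_cat walk_recycle_block // [b \in _]inE => /predU1P[->|bs].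
  split=> [|q qa]; first by rewrite /= inE eqxx.
  by rewrite mem_cat mem_trail_recycle_block.
rewrite -(size_sigma r a) in sa; have [bx bq] := IHs _ sa bs.
rewrite size_sigma in bx bq.
by split=> [|q qa]; rewrite mem_cat ?bx ?bq ?orbT.
Qed.

Lemma canonical_index (k : nat) : all (recycle_index k.+1) (canonical k.+1).
Proof.
case: k => // k; apply/allP => r /canonical_mem-/(_ isT).
by rewrite /recycle_index; lia.
Qed.

Lemma size_canonical (k : nat) : size (canonical k.+1) = k.+1`!.
Proof.
elim: k => // k IHk.
by rewrite [canonical _]/(recycle k.+2 (canonical k.+1)) size_recycle ?canonical_index // IHk.
Qed.

Lemma canonical_cycle (k : nat) (a : seq nat) : size a = k.+1 ->
  walk a (canonical k.+1) = a
  /\ forall b, perm_eq b a -> b \in trail a (canonical k.+1).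
Proof.
elim: k a => [|k IHk] [|x a] // [sz].
  case: a sz => // _; split=> // b bx.
  by rewrite (perm_small_eq _ bx) // inE.
have [clo cov] := IHk a sz.
have idx : all (recycle_index (size a)) (canonical k.+1).
  by rewrite sz canonical_index.
change (walk (x :: a) (recycle k.+2 (canonical k.+1)) = x :: a /\
  forall b, perm_eq b (x :: a) -> b \in trail (x :: a) (recycle k.+2 (canonical k.+1))).
move: (canonical k.+1) clo cov idx => s clo cov idx.
rewrite -sz; split=> [|b bx]; first by rewrite walk_recycle // clo.
have /path.splitPr def_b : x \in b by rewrite (perm_mem bx) inE eqxx.
case: def_b bx => u v.
rewrite -cat1s perm_catCA perm_cons => uv.
have szuv : size u + size v = size a by rewrite -size_cat (perm_size uv).
case: u uv szuv => [|y u] uv szuv.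
  by have [] := mem_trail_recycle x _ _ _ idx (cov _ uv).
(* This inverts [slide]: its value at [rotr 1 v ++ y :: u] and [size v] is [(y :: u) ++ x :: v]. The
   symbol [y] ensures [size v < size a]. *)
have /cov/(mem_trail_recycle x _ _ _ idx)[_ /(_ (size v))] :
  perm_eq (rotr 1 v ++ y :: u) a.
  by rewrite -(permPr uv) perm_catC perm_cat2l perm_rotr.
rewrite /slide drop_size_cat ?size_rotr // take_size_cat ?size_rotr // rotrK.
by apply; rewrite -szuv /=; lia.
Qed.

(** * The blocks of the rewind operation *)

Lemma perm_rconsE (a b : seq nat) (x : nat) :
  perm_eq (rcons a x) (rcons b x) = perm_eq a b.
Proof. by rewrite -!cats1 perm_cat2r. Qed.

Section Rewind.

Variables (k : nat) (T : seq nat).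
Hypothesis canonicalE : canonical k.+1 = [:: k.+1, k.+1 & T].

Lemma all_T (j : nat) : k.+1 <= j -> all (fun r => r <= j) T.
Proof.
move=> kj; have := canonical_index k; rewrite canonicalE /= => /and3P[_ _].
by apply: sub_all => r; rewrite /recycle_index; lia.
Qed.

Lemma size_T : size T = k.+1`! - 2.
Proof. by rewrite -size_canonical canonicalE /= subn2. Qed.

(* The two leading entries of the closed walk canonical k.+1 rotate the whole
   string, which T must undo. *)
Lemma walk_T (a : seq nat) : size a = k.+1 -> walk a T = rotr 1 (rotr 1 a).
Proof.
move=> sz; have [] := canonical_cycle k (rotr 1 (rotr 1 a)).
  by rewrite !size_rotr.
by rewrite canonicalE /= !sigma_size ?size_rot ?size_rotr // !rotrK.
Qed.

(** [T] from [a] is the canonical cycle from [rotr 1 (rotr 1 a)] without its first two steps, so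
    only their starting strings can be missed. *)
Lemma mem_trail_T (a b : seq nat) : size a = k.+1 -> perm_eq b a ->
  [|| b == rotr 1 (rotr 1 a), b == rotr 1 a | b \in trail a T].
Proof.
move=> sz; have [] := canonical_cycle k (rotr 1 (rotr 1 a)).
  by rewrite !size_rotr.
rewrite canonicalE /= !sigma_size ?size_rot ?size_rotr // !rotrK => _ cov ba.
by rewrite -!in_cons cov // (permPr (permEl (perm_rotr _ _))) (permPr (permEl (perm_rotr _ _))).
Qed.

Lemma walk_T_rcons (a : seq nat) (x : nat) : size a = k.+1 ->
  walk (rcons a x) T = rcons (rotr 1 (rotr 1 a)) x.
Proof. by move=> sz; rewrite walk_rcons ?all_T ?sz // walk_T. Qed.

Lemma walk_full (a : seq nat) (x : nat) : size a = k.+1 ->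
  walk (rcons a x) (T ++ [:: k.+1; k.+2]) = rot 1 (rcons (rotr 1 a) x).
Proof.
move=> sz; rewrite walk_cat walk_T_rcons //= sigma_rcons ?size_rotr ?sz //.
by rewrite (sigma_size k.+1) ?size_rotr // rotrK sigma_size // size_rcons size_rotr sz.
Qed.

(** The two strings that [T] may miss are those to which [k.+1] and [k.+2] are then applied. *)
Lemma mem_trail_full (a b : seq nat) (x : nat) : size a = k.+1 ->
  perm_eq b a -> rcons b x \in trail (rcons a x) (T ++ [:: k.+1; k.+2]).
Proof.
move=> sz ba; rewrite trail_cat trail_rcons ?all_T ?sz // walk_T_rcons //=.
rewrite sigma_rcons ?size_rotr ?sz // sigma_size ?size_rotr // rotrK.
rewrite mem_cat !inE; case/or3P: (mem_trail_T a b sz ba) => [/eqP->|/eqP->|bT].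
- by rewrite eqxx orbT.
- by rewrite eqxx !orbT.
- by rewrite (map_f (rcons^~ x)).
Qed.

(** If [a] is a' y, both sides are a' x y. This puts the ends of blocks into the form [sigma k.+1 w]
    from which the next block starts. *)
Lemma rot_rcons_rotr (a : seq nat) (x : nat) : size a = k.+1 ->
  rot 1 (rcons (rotr 1 a) x) = sigma k.+1 (rotr 1 (rcons a x)).
Proof.
case/lastP: a => // a y; rewrite size_rcons !rotr1_rcons => -[sz].
by rewrite -rcons_cons sigma_rcons ?sigma_size /= ?sz // !rot1_cons.
Qed.

Lemma walk_partial (w : seq nat) : size w = k.+2 ->
  walk (sigma k.+1 w) (T ++ [:: k.+2]) = sigma k.+1 (rotr 1 w).
Proof.
case/lastP: w => // a x; rewrite size_rcons => -[sz].
rewrite sigma_rcons ?sz // sigma_size // walk_cat walk_T_rcons ?size_rot //=.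
by rewrite sigma_size ?size_rcons ?size_rotr ?size_rot ?sz // rotK rot_rcons_rotr.
Qed.

(** With [w = rcons a x], [T] from [rot 1 a] may miss [rotr 1 a] and [a]; the former is where the
    final [k.+2] is applied, the latter gives [w]. *)
Lemma mem_trail_partial (b w : seq nat) : size w = k.+2 ->
  perm_eq b w -> last 0 b = last 0 w -> b != w ->
  b \in trail (sigma k.+1 w) (T ++ [:: k.+2]).
Proof.
case/lastP: w => // a x; rewrite size_rcons => -[sz].
case/lastP: b => [|b y]; first by move/perm_size; rewrite size_rcons.
rewrite !last_rcons => + yx; rewrite {}yx perm_rconsE eqseq_rcons eqxx andbT => ba ba'.
rewrite sigma_rcons ?sz // sigma_size //.
rewrite trail_cat trail_rcons ?all_T ?size_rot ?sz // walk_T_rcons ?size_rot //= rotK.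
have /(mem_trail_T (rot 1 a) b) : size (rot 1 a) = k.+1 by rewrite size_rot.
rewrite (permPr (permEl (perm_rot 1 a))) rotK (negbTE ba') => /(_ ba)/=.
by rewrite mem_cat inE => /orP[/eqP->|bT]; rewrite ?eqxx ?orbT // (map_f (rcons^~ x)).
Qed.

(** * Descending strings and the whole rewound walk *)

Definition descending (i : nat) : seq nat := rev (rot i (iota 1 k.+2)).

Lemma size_descending (i : nat) : size (descending i) = k.+2.
Proof. by rewrite size_rev size_rot size_iota. Qed.

Lemma descendingS (i : nat) : i < k.+2 ->
  rotr 1 (descending i) = descending i.+1.
Proof.
by move=> ik; rewrite /descending -rev_rot -rotS // size_iota.
Qed.

Lemma last_descending (i : nat) : i < k.+2 -> last 0 (descending i) = i.+1.
Proof.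
move=> ik; rewrite /descending /rot (drop_nth 0) ?size_iota // nth_iota //.
by rewrite cat_cons rev_cons last_rcons.
Qed.

Lemma perm_descending (i : nat) : perm_eq (descending i) (iota 1 k.+2).
Proof. by rewrite perm_rev perm_rot. Qed.

Lemma walk_partials (i p : nat) : i + p < k.+2 ->
  walk (sigma k.+1 (descending i)) (flatten (nseq p (T ++ [:: k.+2])))
  = sigma k.+1 (descending (i + p)).
Proof.
elim: p i => [|p IHp] i ip; first by rewrite addn0.
rewrite -[nseq _ _]/(_ :: nseq p _) -cat1s flatten_cat walk_cat /= cats0.
by rewrite walk_partial ?size_descending // descendingS ?IHp ?addSnnS //; lia.
Qed.

Lemma mem_trail_partials (i p j : nat) (b : seq nat) :
  i + p < k.+2 -> i <= j < i + p ->
  perm_eq b (iota 1 k.+2) -> last 0 b = j.+1 -> b != descending j ->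
  b \in trail (sigma k.+1 (descending i)) (flatten (nseq p (T ++ [:: k.+2]))).
Proof.
elim: p i => [|p IHp] i ip ijp bi bj bD; first by lia.
rewrite -[nseq _ _]/(_ :: nseq p _) -cat1s flatten_cat trail_cat /= cats0 mem_cat.
rewrite walk_partial ?size_descending // descendingS; last by lia.
have [ij|ij] := eqVneq i j; last by rewrite IHp ?orbT //; lia.
rewrite -ij in bj bD; rewrite mem_trail_partial ?size_descending //.
  by rewrite (permPr (perm_descending i)).
by rewrite last_descending //; lia.
Qed.

Lemma walk_descending (i : nat) : i < k.+2 ->
  walk (descending i) (nseq i k.+2) = descending 0.
Proof.
elim: i => // i IHi ik /=; rewrite -descendingS; last by lia.
by rewrite sigma_size ?size_rotr ?size_descending // rotrK IHi //; lia.
Qed.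

(** [descending 0] is the endpoint of this walk and so not in the trail, hence [0 < j]. *)
Lemma mem_trail_descending (i j : nat) : i < k.+2 -> 0 < j <= i ->
  descending j \in trail (descending i) (nseq i k.+2).
Proof.
elim: i => [|i IHi] ik ji; first by lia.
rewrite /= inE; have [->|ij] := eqVneq j i.+1; first by rewrite eqxx.
rewrite -descendingS; last by lia.
by rewrite sigma_size ?size_rotr ?size_descending // rotrK IHi ?orbT //; lia.
Qed.

Definition rewound (p : nat) : seq nat :=
  (T ++ [:: k.+1; k.+2]) ++ flatten (nseq p (T ++ [:: k.+2]))
  ++ (T ++ [:: k.+1; k.+2]) ++ nseq p k.+2.

(** Each of the [p] partial blocks is one entry short of a full cycle; the [p] closing rotations
    make up for it. *)
Lemma size_rewound (p : nat) : 2 <= k.+1`! -> size (rewound p) = p.+2 * k.+1`!.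
Proof.
rewrite /rewound !size_cat size_flatten /shape map_nseq sumn_nseq size_nseq.
rewrite size_cat size_T /=; nia.
Qed.

Lemma mem_trail_full_perm (u b : seq nat) : size u = k.+2 ->
  perm_eq b u -> last 0 b = last 0 u ->
  b \in trail u (T ++ [:: k.+1; k.+2]).
Proof.
case/lastP: u => // a x; rewrite size_rcons => -[sz].
case/lastP: b => [|b y]; first by move/perm_size; rewrite size_rcons.
rewrite !last_rcons => + yx; rewrite {}yx perm_rconsE.
exact: mem_trail_full.
Qed.

Lemma rewound_start : walk (descending 0) (T ++ [:: k.+1; k.+2])
  = sigma k.+1 (descending 1).
Proof.
rewrite -(descendingS 0) //.
case/lastP: (descending 0) (size_descending 0) => // a x; rewrite size_rcons => -[sz].
by rewrite walk_full // rot_rcons_rotr.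
Qed.

(** The prefix of the start is already rotated by one, which cancels the [rotr 1] in [walk_full]; a
    full left rotation of [descending i.+1] remains. *)
Lemma rewound_end (i : nat) : i < k.+1 ->
  walk (sigma k.+1 (descending i.+1)) (T ++ [:: k.+1; k.+2]) = descending i.
Proof.
move=> ik; rewrite -[RHS](rotrK 1) descendingS; last by lia.
case/lastP: (descending i.+1) (size_descending i.+1) => // a x.
rewrite size_rcons => -[sz].
by rewrite sigma_rcons ?sz // sigma_size // walk_full ?size_rot // rotK.
Qed.

Lemma walk_rewound (p : nat) : p < k.+1 ->
  walk (descending 0) (rewound p) = descending 0.
Proof.
move=> pk; rewrite walk_cat rewound_start walk_cat walk_partials ?add1n //.
by rewrite walk_cat rewound_end // walk_descending //; lia.
Qed.

Lemma last_sigma (w : seq nat) : size w = k.+2 ->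
  last 0 (sigma k.+1 w) = last 0 w.
Proof.
case/lastP: w => // a x; rewrite size_rcons => -[sz].
by rewrite sigma_rcons ?sz // !last_rcons.
Qed.

Lemma mem_trail_rewound (p : nat) (b : seq nat) : p < k.+1 ->
  perm_eq b (iota 1 k.+2) -> last 0 b <= p.+2 ->
  b \in trail (descending 0) (rewound p).
Proof.
move=> pk bi bp; rewrite /rewound trail_cat rewound_start (trail_cat _ (flatten _)).
rewrite walk_partials ?add1n // (trail_cat _ _ (nseq _ _)) rewound_end // !mem_cat.
have b0 : 0 < last 0 b.
  have : last 0 b \in iota 1 k.+2.
    rewrite -(perm_mem bi); case: b bi {bp} => [/perm_size|x b _] //.
    exact: mem_last.
  by rewrite mem_iota => /andP[].
have bD i : perm_eq b (descending i) by rewrite (permPr (perm_descending i)).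
have [b1|b1] := eqVneq (last 0 b) 1.
  by rewrite mem_trail_full_perm ?size_descending // last_descending.
have [bp'|bp'] := eqVneq (last 0 b) p.+2.
  rewrite (_ : b \in trail (sigma _ (descending p.+1)) _) ?orbT //.
  apply: mem_trail_full_perm; rewrite ?size_sigma ?size_descending //.
    by rewrite (permPr (perm_sigma _ _)).
  by rewrite last_sigma ?size_descending // last_descending //; lia.
have [j bj] : exists j, last 0 b = j.+1 by exists (last 0 b).-1; lia.
(* Now [1 <= j <= p]: the closing rotations contain [descending j], the partial blocks all other
   strings ending in [j.+1]. *)
have [->|bDj] := eqVneq b (descending j).
  by rewrite mem_trail_descending ?orbT //; lia.
by rewrite (mem_trail_partials _ _ j) ?orbT //; lia.
Qed.

End Rewind.

(** * Counting the nodes and concluding *)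

Lemma size_rot_nodes (k m : nat) : m <= k.+1 ->
  m * k`! <= size (rot_nodes k.+1 m).
Proof.
(* Each last symbol [j <= m] leaves k! arrangements of the other symbols. *)
move=> mk; pose s := [seq rcons b j | j <- iota 1 m,
  b <- permutations (rem j (iota 1 k.+1))].
have sz : size s = m * k`!.
  rewrite size_allpairs_dep; set t := map _ _.
  have /all_pred1P-> : all (pred1 k`!) t.
    rewrite all_map; apply/allP => j; rewrite mem_iota => jm.
    have ji : j \in iota 1 k.+1 by rewrite mem_iota; lia.
    apply/eqP; rewrite -[LHS]/(size (permutations (rem j (iota 1 k.+1)))).
    by rewrite size_permutations ?rem_uniq ?iota_uniq // size_rem // size_iota.
  by rewrite sumn_nseq size_map size_iota mulnC.
rewrite -sz; apply: uniq_leq_size.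
  apply: allpairs_uniq_dep => [|j _|]; rewrite ?iota_uniq ?permutations_uniq //.
  by move=> [i b] [j c] _ _ /= /rcons_inj[-> ->].
move=> w /allpairsPdep[j [b [jm]]]; rewrite !mem_permutations => bj ->.
rewrite mem_filter last_rcons mem_permutations.
have ji : j \in iota 1 k.+1 by move: jm; rewrite !mem_iota; lia.
move: jm; rewrite mem_iota => jm; apply/andP; split; first by lia.
by rewrite perm_rcons perm_sym (permPl (perm_to_rem ji)) perm_cons perm_sym.
Qed.

Theorem theorem8 (n m : nat) (hn : 4 <= n) (hm : 2 <= m <= n) :
  hamilton_sequence n [:: n - 2; n - 1; n] m
    (rewind n m (rot 2 (canonical (n - 1)))).
Proof.
case: n hn hm => [|[|k]] // hn hm; rewrite subn2 subn1 /=.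
have [T rotT] : exists T, rot 2 (canonical k.+1) = T ++ [:: k.+1; k.+1].
  by apply: canonical_rot2; lia.
have canT : canonical k.+1 = [:: k.+1, k.+1 & T].
  by apply: (@rot_inj 2); rewrite rotT /rot /= drop0 take0.
have -> : rewind k.+2 m (rot 2 (canonical k.+1)) = rewound k T (m - 2).
  by rewrite /rewind rotT size_cat addnK take_size_cat // subn1.
have sz : size (rewound k T (m - 2)) = m * k.+1`!.
  have mE : (m - 2).+2 = m by lia.
  rewrite (size_rewound _ _ canT) ?mE //.
  by apply: (leq_trans _ (fact_geq _)); lia.
have D0 : rev (iota 1 k.+2) = descending k 0 by rewrite /descending rot0.
have sub : {subset rot_nodes k.+2 m <= trail (rev (iota 1 k.+2)) (rewound k T (m - 2))}.
  move=> b; rewrite mem_filter mem_permutations => /andP[bm bi].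
  by rewrite D0; apply: mem_trail_rewound => //; lia.
have nodesU : uniq (rot_nodes k.+2 m) by rewrite filter_uniq ?permutations_uniq.
have le_sz : size (trail (rev (iota 1 k.+2)) (rewound k T (m - 2)))
  <= size (rot_nodes k.+2 m).
  by rewrite size_trail sz size_rot_nodes //; lia.
(* The distinct nodes all lie in the trail and are at least as many as its entries, so both lists
   have the same size and members. *)
have [eq_sz eq_nodes] := uniq_min_size nodesU sub le_sz.
split.
- by rewrite eq_sz size_trail.
- have all_T : all (fun r => r \in [:: k; k.+1; k.+2]) T.
    have := canonical_index k; rewrite canT /= => /and3P[_ _].
    by apply: sub_all => r /andP[_ /orP[]/eqP rk]; rewrite !inE; lia.
  have all_flat p : all (fun r => r \in [:: k; k.+1; k.+2])
      (flatten (nseq p (T ++ [:: k.+2]))).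
    by elim: p => //= p IHp; rewrite !all_cat all_T IHp /= !inE eqxx !orbT.
  apply/allP; rewrite /rewound !all_cat all_flat all_T all_nseq /=.
  by rewrite !inE !eqxx !orbT.
- by rewrite mkseq_visit (leq_size_uniq nodesU sub).
- by move=> b; rewrite mkseq_visit eq_nodes.
- rewrite /visit take_size take0 /=.
  by rewrite D0; apply: walk_rewound => //; lia.
Qed.
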